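(* Let $\hat A\in\mathbb{DQ}^{n\times n}$ be Hermitian, let $\hat{\mathbf u}_0\in\mathbb{DQ}^n$ be any initial vector with $\|\hat{\mathbf u}_0\|_2=1$, and let $\hat\theta_k,\hat{\mathbf u}_k$ be generated by the Rayleigh quotient iteration applied to $\hat A$ started at $\hat{\mathbf u}_0$. Let $\hat{\mathbf r}_k=(\hat A-\hat\theta_kI)\hat{\mathbf u}_k$ be the residual at the $k$-th step. Then the sequence $\{\|\hat{\mathbf r}_k\|_2,\ k=0,1,\dots\}$ is monotonically decreasing, i.e. $\|\hat{\mathbf r}_{k+1}\|_2\le\|\hat{\mathbf r}_k\|_2$ in the order of dual numbers for each $k$.
   Context: $\mathbb D=\{q_{\mathrm{st}}+q_{\mathcal I}\epsilon: q_{\mathrm{st}},q_{\mathcal I}\in\mathbb R\}$ is the ring of dual numbers ($\epsilon^2=0$), totally ordered by: $p<q$ iff $p_{\mathrm{st}}<q_{\mathrm{st}}$, or $p_{\mathrm{st}}=q_{\mathrm{st}}$ and $p_{\mathcal I}<q_{\mathcal I}$. $\mathbb{DQ}=\{\tilde q_{\mathrm{st}}+\tilde q_{\mathcal I}\epsilon\}$, with $\tilde q_{\mathrm{st}},\tilde q_{\mathcal I}$ real quaternions and $\epsilon$ commuting with quaternions, is the ring of dual quaternions; an element (or vector) is appreciable if its standard part (the part without $\epsilon$) is nonzero. The conjugate is $\hat q^*=\tilde q_{\mathrm{st}}^*+\tilde q_{\mathcal I}^*\epsilon$; $\hat A^*$ and $\hat{\mathbf x}^*$ are conjugate transposes, and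 $\hat A$ is Hermitian if $\hat A^*=\hat A$. For Hermitian $\hat A$, $\hat{\mathbf x}^*\hat A\hat{\mathbf x}$ is a dual number. For $q\in\mathbb D$ with $q_{\mathrm{st}}>0$, $\sqrt q=\sqrt{q_{\mathrm{st}}}+\frac{q_{\mathcal I}}{2\sqrt{q_{\mathrm{st}}}}\epsilon$. The magnitude is $|\hat q|=|\tilde q_{\mathrm{st}}|+\frac{\tilde q_{\mathrm{st}}\tilde q_{\mathcal I}^*+\tilde q_{\mathcal I}\tilde q_{\mathrm{st}}^*}{2|\tilde q_{\mathrm{st}}|}\epsilon$ if $\tilde q_{\mathrm{st}}\ne0$, and $|\hat q|=|\tilde q_{\mathcal I}|\epsilon$ otherwise. The 2-norm of $\hat{\mathbf x}=\tilde{\mathbf x}_{\mathrm{st}}+\tilde{\mathbf x}_{\mathcal I}\epsilon\in\mathbb{DQ}^n$ is the dual number $\|\hat{\mathbf x}\|_2=\sqrt{\sum_i|\hat x_i|^2}$ if $\tilde{\mathbf x}_{\mathrm{st}}\ne0$, and $\|\hat{\mathbf x}\|_2=\sqrt{\sum_i|\tilde x_{i,\mathcal I}|^2}\,\epsilon$ if $\tilde{\mathbf x}_{\mathrm{st}}=0$. Rayleigh quotient iteration: given $\hat{\mathbf u}_0$ with $\|\hat{\mathbf u}_0\|_2=1$, for $k=0,1,2,\dots$ set $\hat\theta_k=\hat{\mathbf u}_k^*\hat A\hat{\mathbf u}_k$; if $\hat A-\hat\theta_kI$ is singular (not invertible), the iteration stops; otherwise solve $(\hat A-\hat\theta_kI)\hat{\mathbf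 w}_{k+1}=\hat{\mathbf u}_k$ and set $\hat{\mathbf u}_{k+1}=\hat{\mathbf w}_{k+1}/\|\hat{\mathbf w}_{k+1}\|_2$. The inequality concerns those $k$ for which $\hat{\mathbf u}_{k+1}$ is produced by this solve-and-normalize step. *)

(* Defs.v *)
From HB Require Import structures.
From mathcomp Require Import all_boot all_order all_algebra.
From mathcomp Require Import ring.
From mathcomp Require Import reals.

Set Implicit Arguments.
Unset Strict Implicit.
Unset Printing Implicit Defensive.

Import Order.TTheory GRing.Theory Num.Theory.
Local Open Scope ring_scope.

(* [Quaternion a b c d] is a + b i + c j + d k. *)
Record quaternion (R : Type) :=
  Quaternion { qre : R; qi : R; qj : R; qk : R }.

(* [DualElt a b] is a + b eps, with eps central and eps^2 = 0.  Over [R] these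
   are the dual numbers; over [quaternion R], the dual quaternions. *)
Record dualext (T : Type) := DualElt { stpart : T; infpart : T }.

Section QuaternionChoice.
Variable R : Type.
Definition tuple_of_quaternion (q : quaternion R) := (qre q, qi q, qj q, qk q).
Definition quaternion_of_tuple (p : R * R * R * R) :=
  let: (a, b, c, d) := p in Quaternion a b c d.
Lemma tuple_of_quaternionK : cancel tuple_of_quaternion quaternion_of_tuple.
Proof. by case. Qed.
End QuaternionChoice.

HB.instance Definition _ (R : choiceType) :=
  Choice.copy (quaternion R) (can_type (@tuple_of_quaternionK R)).

Section QuaternionRing.
Variable R : comNzRingType.
Implicit Types p q : quaternion R.

Definition qzero : quaternion R := Quaternion 0 0 0 0.
Definition qone : quaternion R := Quaternion 1 0 0 0.
Definition qopp p := Quaternion (- qre p) (- qi p) (- qj p) (- qk p).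
Definition qadd p q :=
  Quaternion (qre p + qre q) (qi p + qi q) (qj p + qj q) (qk p + qk q).
Definition qmul p q := Quaternion
  (qre p * qre q - qi p * qi q - qj p * qj q - qk p * qk q)
  (qre p * qi q + qi p * qre q + qj p * qk q - qk p * qj q)
  (qre p * qj q - qi p * qk q + qj p * qre q + qk p * qi q)
  (qre p * qk q + qi p * qj q - qj p * qi q + qk p * qre q).

Fact qaddA : associative qadd.
Proof. by move=> [? ? ? ?] [? ? ? ?] [? ? ? ?]; congr Quaternion => /=; ring. Qed.
Fact qaddC : commutative qadd.
Proof. by move=> [? ? ? ?] [? ? ? ?]; congr Quaternion => /=; ring. Qed.
Fact qadd0 : left_id qzero qadd.
Proof. by move=> [? ? ? ?]; congr Quaternion; rewrite /= add0r. Qed.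
Fact qaddN : left_inverse qzero qopp qadd.
Proof. by move=> [? ? ? ?]; congr Quaternion; rewrite /= addNr. Qed.

HB.instance Definition _ :=
  GRing.isZmodule.Build (quaternion R) qaddA qaddC qadd0 qaddN.

Fact qmulA : associative qmul.
Proof. by move=> [? ? ? ?] [? ? ? ?] [? ? ? ?]; congr Quaternion => /=; ring. Qed.
Fact qmul1l : left_id qone qmul.
Proof. by move=> [? ? ? ?]; congr Quaternion => /=; ring. Qed.
Fact qmul1r : right_id qone qmul.
Proof. by move=> [? ? ? ?]; congr Quaternion => /=; ring. Qed.
Fact qmulDl : left_distributive qmul +%R.
Proof. by move=> [? ? ? ?] [? ? ? ?] [? ? ? ?]; congr Quaternion => /=; ring. Qed.
Fact qmulDr : right_distributive qmul +%R.
Proof. by move=> [? ? ? ?] [? ? ? ?] [? ? ? ?]; congr Quaternion => /=; ring. Qed.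
Fact qone_neq0 : qone != 0.
Proof. by apply/eqP => -[/eqP]; rewrite oner_eq0. Qed.

HB.instance Definition _ := GRing.Zmodule_isNzRing.Build (quaternion R)
  qmulA qmul1l qmul1r qmulDl qmulDr qone_neq0.

Definition qconj q := Quaternion (qre q) (- qi q) (- qj q) (- qk q).
Definition qreal (a : R) : quaternion R := Quaternion a 0 0 0.
End QuaternionRing.

Section DualChoice.
Variable T : Type.
Definition pair_of_dual (x : dualext T) := (stpart x, infpart x).
Definition dual_of_pair (p : T * T) := DualElt p.1 p.2.
Lemma pair_of_dualK : cancel pair_of_dual dual_of_pair.
Proof. by case. Qed.
End DualChoice.

HB.instance Definition _ (T : choiceType) :=
  Choice.copy (dualext T) (can_type (@pair_of_dualK T)).

Section DualRing.
Variable T : nzRingType.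
Implicit Types x y : dualext T.

Definition dual0 : dualext T := DualElt 0 0.
Definition dual1 : dualext T := DualElt 1 0.
Definition dopp x := DualElt (- stpart x) (- infpart x).
Definition dadd x y := DualElt (stpart x + stpart y) (infpart x + infpart y).
Definition dmul x y :=
  DualElt (stpart x * stpart y) (stpart x * infpart y + infpart x * stpart y).

Fact daddA : associative dadd.
Proof. by move=> [? ?] [? ?] [? ?]; congr DualElt; rewrite /= addrA. Qed.
Fact daddC : commutative dadd.
Proof. by move=> [? ?] [? ?]; congr DualElt; rewrite /= addrC. Qed.
Fact dadd0 : left_id dual0 dadd.
Proof. by move=> [? ?]; congr DualElt; rewrite /= add0r. Qed.
Fact daddN : left_inverse dual0 dopp dadd.
Proof. by move=> [? ?]; congr DualElt; rewrite /= addNr. Qed.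

HB.instance Definition _ :=
  GRing.isZmodule.Build (dualext T) daddA daddC dadd0 daddN.

Fact dmulA : associative dmul.
Proof.
move=> [a a'] [b b'] [c c']; congr DualElt; rewrite /= ?mulrA //.
by rewrite mulrDr mulrDl !mulrA addrA.
Qed.
Fact dmul1l : left_id dual1 dmul.
Proof. by move=> [? ?]; congr DualElt; rewrite /= ?mul0r ?addr0 mul1r. Qed.
Fact dmul1r : right_id dual1 dmul.
Proof. by move=> [? ?]; congr DualElt; rewrite /= ?mulr0 ?add0r mulr1. Qed.
Fact dmulDl : left_distributive dmul +%R.
Proof.
by move=> [? ?] [? ?] [? ?]; congr DualElt; rewrite /= ?mulrDl // addrACA.
Qed.
Fact dmulDr : right_distributive dmul +%R.
Proof.
by move=> [? ?] [? ?] [? ?]; congr DualElt; rewrite /= ?mulrDr // addrACA.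
Qed.
Fact dual1_neq0 : dual1 != 0.
Proof. by apply/eqP => -[/eqP]; rewrite oner_eq0. Qed.

HB.instance Definition _ := GRing.Zmodule_isNzRing.Build (dualext T)
  dmulA dmul1l dmul1r dmulDl dmulDr dual1_neq0.
End DualRing.

Section DualComRing.
Variable T : comNzRingType.
Fact dmulC : commutative (@dmul T).
Proof.
move=> [a a'] [b b']; congr DualElt => /=; first by rewrite mulrC.
by rewrite addrC mulrC (mulrC a).
Qed.
HB.instance Definition _ :=
  GRing.PzRing_hasCommutativeMul.Build (dualext T) dmulC.
End DualComRing.

(* The units are the elements with invertible standard part. *)
Section DualUnit.
Variable T : comUnitRingType.
Implicit Types x y : dualext T.

Definition dunit : {pred dualext T} := fun x => stpart x \is a GRing.unit.
Definition dinv x :=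
  if dunit x then DualElt (stpart x)^-1 (- (infpart x / stpart x ^+ 2)) else x.

Fact dmulVx : {in dunit, left_inverse 1 dinv *%R}.
Proof.
move=> [a b] ua; rewrite /dinv ifT //; congr DualElt; rewrite /= ?mulVr //.
by rewrite mulNr expr2 invrM // -!mulrA mulVr // mulr1 mulrC subrr.
Qed.
Fact dunitPl : forall x y, y * x = 1 -> dunit x.
Proof. by move=> [a ?] [b ?] [ba1 _]; apply/unitrPr; exists b; rewrite mulrC. Qed.
Fact dinv_out : {in [predC dunit], dinv =1 id}.
Proof. by move=> x; rewrite /dinv inE /= => /negbTE nu; rewrite ifF. Qed.

HB.instance Definition _ := GRing.ComNzRing_hasMulInverse.Build (dualext T)
  dmulVx dunitPl dinv_out.
End DualUnit.

Fact dual_number_display : Order.disp_t. Proof. exact: Order.Disp tt tt. Qed.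

Section DualOrder.
Variable R : realDomainType.
Implicit Types p q : dualext R.

Definition dlt p q :=
  (stpart p < stpart q) || (stpart p == stpart q) && (infpart p < infpart q).
Definition dle p q := (p == q) || dlt p q.

Fact dle_def p q : dle p q = (p == q) || dlt p q. Proof. by []. Qed.
Fact dlt_irr : irreflexive dlt.
Proof. by move=> p; rewrite /dlt !ltxx andbF. Qed.
Fact dlt_trans : transitive dlt.
Proof.
move=> [b b'] [a a'] [c c']; rewrite /dlt /=.
move=> /orP[ab|/andP[/eqP-> ab]] /orP[bc|/andP[/eqP<- bc]].
- by rewrite (lt_trans ab bc).
- by rewrite ab.
- by rewrite bc.
- by rewrite eqxx (lt_trans ab bc) orbT.
Qed.
Fact dlt_total p q : p != q -> dlt p q || dlt q p.
Proof.
move: p q => [a a'] [b b']; rewrite /dlt /=.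
case: (ltgtP a b) => //= ->.
by case: (ltgtP a' b') => //= ->; rewrite eqxx.
Qed.

HB.instance Definition _ :=
  Order.LtOrder.Build dual_number_display (dualext R)
    dle_def (fun _ _ => erefl) (fun _ _ => erefl) dlt_irr dlt_trans dlt_total.
End DualOrder.

Section DualQuaternions.
Variable R : realType.

Definition dual_number := dualext R.
Definition dual_quaternion := dualext (quaternion R).

Definition dq_of_dual (p : dual_number) : dual_quaternion :=
  DualElt (qreal (stpart p)) (qreal (infpart p)).

Definition dqconj (q : dual_quaternion) : dual_quaternion :=
  DualElt (qconj (stpart q)) (qconj (infpart q)).

Definition qnorm (q : quaternion R) : R :=
  Num.sqrt (qre q ^+ 2 + qi q ^+ 2 + qj q ^+ 2 + qk q ^+ 2).

(* Meaningful only when [0 < stpart p]. *)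
Definition dsqrt (p : dual_number) : dual_number :=
  DualElt (Num.sqrt (stpart p)) (infpart p / (2 * Num.sqrt (stpart p))).

(* The quaternion under [qre] equals its own conjugate, so it is real and [qre]
   only changes its type. *)
Definition dqmagnitude (q : dual_quaternion) : dual_number :=
  if stpart q != 0 then
    DualElt (qnorm (stpart q))
      (qre (stpart q * qconj (infpart q) + infpart q * qconj (stpart q))
       / (2 * qnorm (stpart q)))
  else DualElt 0 (qnorm (infpart q)).

Section Matrices.
Variable n : nat.

Definition adjmx m (A : 'M[dual_quaternion]_(m, n)) :
  'M[dual_quaternion]_(n, m) := (map_mx dqconj A)^T.

Definition dqhermitian (A : 'M[dual_quaternion]_n) := adjmx A = A.

Definition mxinvertible (A : 'M[dual_quaternion]_n) :=
  exists B : 'M[dual_quaternion]_n, A *m B = 1%:M /\ B *m A = 1%:M.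

Definition appreciable (x : 'cV[dual_quaternion]_n) :=
  map_mx (@stpart (quaternion R)) x != 0.

Definition norm2 (x : 'cV[dual_quaternion]_n) : dual_number :=
  if appreciable x then dsqrt (\sum_i dqmagnitude (x i 0) ^+ 2)
  else DualElt 0 (Num.sqrt (\sum_i qnorm (infpart (x i 0)) ^+ 2)).

(* Step [k] is reached when none of the earlier shifted matrices was singular. *)
Definition rqi_reached (A : 'M[dual_quaternion]_n)
    (theta : nat -> dual_quaternion) (k : nat) : Prop :=
  forall j, (j < k)%N -> mxinvertible (A - (theta j)%:M).

End Matrices.

(* [u] and [theta] are total sequences, unconstrained after the iteration has
   stopped.  For Hermitian [A], [theta k] is a dual number; it is kept here as
   an element of the dual quaternions. *)
Definition rqi n (A : 'M[dual_quaternion]_n) (u0 : 'cV[dual_quaternion]_n)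
    (u : nat -> 'cV[dual_quaternion]_n) (theta : nat -> dual_quaternion) : Prop :=
  u 0%N = u0 /\
  forall k, rqi_reached A theta k ->
    theta k = (adjmx (u k) *m A *m u k) 0 0 /\
    (mxinvertible (A - (theta k)%:M) ->
     exists w : 'cV[dual_quaternion]_n,
       (A - (theta k)%:M) *m w = u k /\
       u k.+1 = dq_of_dual (norm2 w)^-1 *: w).

End DualQuaternions.

(* Main.v *)
(** Write <x, y> for x^* y and N x for the dual number <x, x>; [norm2 x] is the
    square root of N x as soon as x is appreciable.  If N u = 1 and <u, x> is a
    dual number t, then N (x - t u) = N x - t^2.  With v = u_{k+1} and
    w = w_{k+1}, this identity is used twice:
    - for x = (A - theta_k) v it gives r_{k+1} = x - t v, where
      t = theta_{k+1} - theta_k, so N r_{k+1} <= N x = 1 / |w|^2, since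
      x = u_k / |w|;
    - for x = r_k it gives 1 / |w|^2 <= N r_k, since <v, r_k> = 1 / |w|.
    Finally r_k is appreciable because A - theta_k is invertible, and the square
    root is monotone on the positive appreciable dual numbers. *)
Require Import Defs.
From HB Require Import structures.
From mathcomp Require Import all_boot all_order all_algebra.
From mathcomp Require Import ring lra.
From mathcomp Require Import reals.
Set Implicit Arguments.
Unset Strict Implicit.
Unset Printing Implicit Defensive.
Import Order.TTheory GRing.Theory Num.Theory.
Local Open Scope ring_scope.

(** * The standard part as a ring morphism *)

Section StandardPart.
Variable T : nzRingType.

Fact stpart_is_zmod_morphism : zmod_morphism (@stpart T).
Proof. by []. Qed.

Fact stpart_is_monoid_morphism : monoid_morphism (@stpart T).
Proof. by []. Qed.

HB.instance Definition _ :=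
  GRing.isZmodMorphism.Build (dualext T) T (@stpart T) stpart_is_zmod_morphism.
HB.instance Definition _ :=
  GRing.isMonoidMorphism.Build (dualext T) T (@stpart T)
    stpart_is_monoid_morphism.
End StandardPart.

(** * The lexicographic order of the dual numbers *)

Section DualNumberOrder.
Variable R : realDomainType.
Implicit Types p q : dualext R.

Lemma dleE p q :
  (p <= q)%O = (stpart p < stpart q) ||
               (stpart p == stpart q) && (infpart p <= infpart q).
Proof.
case: p q => [a a'] [b b']; rewrite le_eqVlt -[(_ < _)%O]/(dlt _ _) /dlt /=.
have -> : (DualElt a a' == DualElt b b') = (a == b) && (a' == b').
  by apply/eqP/andP => [[-> ->]|[/eqP-> /eqP->]].
by rewrite [a' <= b']le_eqVlt; case: (ltgtP a b).
Qed.

Lemma dsubr_ge0 p q : (0 <= q - p :> dualext R)%O = (p <= q)%O.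
Proof. by rewrite !dleE /= subr_gt0 eq_sym subr_eq0 eq_sym subr_ge0. Qed.

Lemma daddr_ge0 p q :
  (0 <= p :> dualext R)%O -> (0 <= q :> dualext R)%O ->
  (0 <= p + q :> dualext R)%O.
Proof.
rewrite !dleE /= => /orP[p0|/andP[/eqP<- p1]] /orP[q0|/andP[/eqP<- q1]].
- by rewrite addr_gt0.
- by rewrite addr0 p0.
- by rewrite add0r q0.
- by rewrite addr0 eqxx addr_ge0 ?orbT.
Qed.

(** Either the standard part is nonzero and its square is positive, or [p] is a multiple of eps and
    its square is zero. *)
Lemma dsqr_ge0 p : (0 <= p ^+ 2 :> dualext R)%O.
Proof.
rewrite dleE /= lt_neqAle sqr_ge0 andbT eq_sym mulf_eq0 orbb.
by have [->|] := eqVneq (stpart p) 0; rewrite ?mul0r ?mulr0 ?addr0 ?lexx.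
Qed.

End DualNumberOrder.

(** * Square roots of dual numbers *)

Section DualSqrt.
Variable R : realType.
Implicit Types p q : dual_number R.

Lemma dsqrtK p : 0 < stpart p -> dsqrt p ^+ 2 = p.
Proof.
case: p => a b /= a0; have s0 : Num.sqrt a != 0 by rewrite gt_eqF ?sqrtr_gt0.
congr DualElt => /=; first by rewrite -expr2 sqr_sqrtr ?ltW.
by field.
Qed.

(** When the standard parts agree, both infinitesimal parts are divided by the same nonnegative
    number. *)
Lemma ler_dsqrt p q : 0 < stpart p -> (p <= q)%O -> (dsqrt p <= dsqrt q)%O.
Proof.
rewrite !dleE /= => p0 /orP[pq|/andP[/eqP<- pq]].
  by rewrite ltr_sqrt ?pq // (lt_trans p0).
by rewrite eqxx ler_wpM2r ?orbT // invr_ge0 mulr_ge0 ?sqrtr_ge0.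
Qed.

End DualSqrt.

(** * Conjugation and magnitude of dual quaternions *)

Section DualQuaternionConj.
Variable R : realType.
Implicit Types p q : dual_quaternion R.
Implicit Types t : dual_number R.

Fact dq_of_dual_is_zmod_morphism : zmod_morphism (@dq_of_dual R).
Proof. by move=> [a b] [c d]; congr DualElt; congr Quaternion => /=; ring. Qed.

Fact dq_of_dual_is_monoid_morphism : monoid_morphism (@dq_of_dual R).
Proof.
split=> [//|[a b] [c d]].
by congr DualElt; congr Quaternion => /=; ring.
Qed.

HB.instance Definition _ :=
  GRing.isZmodMorphism.Build (dual_number R) (dual_quaternion R) (@dq_of_dual R)
    dq_of_dual_is_zmod_morphism.
HB.instance Definition _ :=
  GRing.isMonoidMorphism.Build (dual_number R) (dual_quaternion R)
    (@dq_of_dual R) dq_of_dual_is_monoid_morphism.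

Lemma dq_of_dual_inj : injective (@dq_of_dual R).
Proof. by move=> [a b] [c d] [-> ->]. Qed.

Lemma dq_of_dual_comm t q : dq_of_dual t * q = q * dq_of_dual t.
Proof.
by case: t q => [a b] [[? ? ? ?] [? ? ? ?]];
  congr DualElt; congr Quaternion => /=; ring.
Qed.

Fact dqconj_is_zmod_morphism : zmod_morphism (@dqconj R).
Proof.
by move=> [[? ? ? ?] [? ? ? ?]] [[? ? ? ?] [? ? ? ?]];
  congr DualElt; congr Quaternion => /=; ring.
Qed.

HB.instance Definition _ :=
  GRing.isZmodMorphism.Build (dual_quaternion R) (dual_quaternion R)
    (@dqconj R) dqconj_is_zmod_morphism.

Lemma dqconjM p q : dqconj (p * q) = dqconj q * dqconj p.
Proof.
by move: p q => [[? ? ? ?] [? ? ? ?]] [[? ? ? ?] [? ? ? ?]];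
  congr DualElt; congr Quaternion => /=; ring.
Qed.

Lemma dqconjK : involutive (@dqconj R).
Proof.
by move=> [[? ? ? ?] [? ? ? ?]];
  congr DualElt; congr Quaternion => /=; rewrite opprK.
Qed.

Lemma dqconj_dual t : dqconj (dq_of_dual t) = dq_of_dual t.
Proof. by congr DualElt; congr Quaternion => /=; rewrite oppr0. Qed.

(** Conjugation negates the six imaginary coordinates, so each of them equals its own opposite and
    vanishes. *)
Lemma dqconj_fixed q : dqconj q = q -> exists t, q = dq_of_dual t.
Proof.
case: q => [[a b c d] [a' b' c' d']] [hb hc hd hb' hc' hd'].
exists (DualElt a a'); congr DualElt; congr Quaternion; lra.
Qed.

Lemma qnorm_sqr (x : quaternion R) :
  qnorm x ^+ 2 = qre x ^+ 2 + qi x ^+ 2 + qj x ^+ 2 + qk x ^+ 2.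
Proof. by rewrite sqr_sqrtr // !addr_ge0 ?sqr_ge0. Qed.

Lemma qnorm_eq0 (x : quaternion R) : (qnorm x == 0) = (x == 0).
Proof.
apply/idP/eqP => [|->]; last by rewrite /qnorm /= !expr0n !addr0 sqrtr0.
rewrite -sqrf_eq0 qnorm_sqr !paddr_eq0 ?addr_ge0 ?sqr_ge0 // !sqrf_eq0.
by case: x => [a b c d] /= /andP[/andP[/andP[/eqP-> /eqP->] /eqP->] /eqP->].
Qed.

Lemma dqmagnitude_st q : stpart (dqmagnitude q) = qnorm (stpart q).
Proof.
rewrite /dqmagnitude; case: eqP => //= ->.
by apply/esym/eqP; rewrite qnorm_eq0.
Qed.

Lemma dqmagnitude_sqr q : dq_of_dual (dqmagnitude q ^+ 2) = dqconj q * q.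
Proof.
rewrite /dqmagnitude; case: eqP => [|/eqP] /=; case: q => [x y] /= x0.
  (* With zero standard part, both sides are multiples of eps^2 and vanish. *)
  rewrite x0; case: y => ? ? ? ?.
  by congr DualElt; congr Quaternion => /=; ring.
have n0 : qnorm x != 0 by rewrite qnorm_eq0.
case: y x x0 n0 => [a' b' c' d'] x x0 n0.
have := qnorm_sqr x; case: x x0 n0 => [a b c d] /= _ n0 nE.
congr DualElt; congr Quaternion => /=; rewrite -?expr2 ?nE; try ring.
by field.
Qed.

End DualQuaternionConj.

(** * The quaternionic inner product and the 2-norm *)

Section InnerProduct.
Variables (R : realType) (n : nat).
Implicit Types x y z : 'cV[dual_quaternion R]_n.
Implicit Types M : 'M[dual_quaternion R]_n.
Implicit Types t : dual_number R.

Lemma adjmxM m p (B : 'M[dual_quaternion R]_(p, n))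
    (C : 'M[dual_quaternion R]_(n, m)) :
  adjmx (B *m C) = adjmx C *m adjmx B.
Proof.
apply/matrixP => i j; rewrite !mxE raddf_sum; apply: eq_bigr => k _ /=.
by rewrite dqconjM !mxE.
Qed.

Lemma adjmxK m p (B : 'M[dual_quaternion R]_(m, p)) : adjmx (adjmx B) = B.
Proof. by apply/matrixP => i j; rewrite !mxE dqconjK. Qed.

Lemma adjmxB m p (B C : 'M[dual_quaternion R]_(m, p)) :
  adjmx (B - C) = adjmx B - adjmx C.
Proof. by apply/matrixP => i j; rewrite !mxE raddfB. Qed.

Lemma adjmx_dual t :
  adjmx (dq_of_dual t)%:M = (dq_of_dual t)%:M :> 'M[dual_quaternion R]_n.
Proof.
apply/matrixP => i j; rewrite !mxE eq_sym.
by case: eqP; rewrite ?mulr1n ?mulr0n ?dqconj_dual ?raddf0.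
Qed.

Definition inner x y : dual_quaternion R := (adjmx x *m y) 0 0.

(** This vanishes on every vector that is not appreciable, so it determines [norm2] only on the
    appreciable ones. *)
Definition sqnorm x : dual_number R := \sum_i dqmagnitude (x i 0) ^+ 2.

Lemma inner_conj x y : dqconj (inner x y) = inner y x.
Proof. by rewrite /inner -{2}[x]adjmxK -adjmxM !mxE. Qed.

Lemma innerBr x y z : inner x (y - z) = inner x y - inner x z.
Proof. by rewrite /inner mulmxBr [LHS]mxE [X in _ + X = _]mxE. Qed.

Lemma innerBl x y z : inner (x - y) z = inner x z - inner y z.
Proof. by rewrite /inner adjmxB mulmxBl [LHS]mxE [X in _ + X = _]mxE. Qed.

Lemma innerZr t x y : inner x (dq_of_dual t *: y) = dq_of_dual t * inner x y.
Proof.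
rewrite /inner !mxE mulr_sumr; apply: eq_bigr => i _.
by rewrite !mxE mulrA -dq_of_dual_comm mulrA.
Qed.

Lemma innerZl t x y : inner (dq_of_dual t *: x) y = dq_of_dual t * inner x y.
Proof.
by rewrite -inner_conj innerZr dqconjM inner_conj dqconj_dual dq_of_dual_comm.
Qed.

Lemma inner_mul M x y : inner x (M *m y) = inner (adjmx M *m x) y.
Proof. by rewrite /inner adjmxM adjmxK mulmxA. Qed.

Lemma innerxx x : inner x x = dq_of_dual (sqnorm x).
Proof.
rewrite /inner mxE raddf_sum; apply: eq_bigr => i _.
by rewrite [RHS]dqmagnitude_sqr !mxE.
Qed.

Lemma sqnormZ t x : sqnorm (dq_of_dual t *: x) = t ^+ 2 * sqnorm x.
Proof.
apply: dq_of_dual_inj.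
by rewrite -innerxx innerZl innerZr innerxx expr2 !rmorphM /= mulrA.
Qed.

Lemma sqnorm_ge0 x : (0 <= sqnorm x :> dual_number R)%O.
Proof.
apply: (big_ind (fun p : dual_number R => (0 <= p :> dual_number R)%O)) => //.
  exact: daddr_ge0.
by move=> i _; exact: dsqr_ge0.
Qed.

(** Pythagoras: a dual [t] is central and self-conjugate, so each cross term contributes -t^2 and
    the last term +t^2. *)
Lemma sqnorm_sub_proj t x y :
  sqnorm x = 1 -> inner x y = dq_of_dual t ->
  sqnorm (y - dq_of_dual t *: x) = sqnorm y - t ^+ 2.
Proof.
move=> x1 xy; apply: dq_of_dual_inj.
have yx : inner y x = dq_of_dual t by rewrite -inner_conj xy dqconj_dual.
rewrite -innerxx innerBl !innerBr !innerZl !innerZr !innerxx x1 xy yx.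
by rewrite -!rmorphM -!rmorphB; congr dq_of_dual; ring.
Qed.

Lemma sqnorm_st x : stpart (sqnorm x) = \sum_i qnorm (stpart (x i 0)) ^+ 2.
Proof.
rewrite /sqnorm raddf_sum; apply: eq_bigr => i _.
by rewrite /= dqmagnitude_st expr2.
Qed.

(** The standard part is a sum of real squares, which is zero only if every term is. *)
Lemma appreciableE x : appreciable x = (0 < stpart (sqnorm x)).
Proof.
rewrite sqnorm_st lt_neqAle sumr_ge0 ?andbT; last by move=> i _; exact: sqr_ge0.
rewrite /appreciable [0 == _]eq_sym psumr_eq0; last first.
  by move=> i _; exact: sqr_ge0.
congr (~~ _); apply/eqP/allP => [x0 i _|h] /=.
  by rewrite sqrf_eq0 qnorm_eq0; move/matrixP/(_ i 0): x0; rewrite !mxE => ->.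
apply/matrixP => i j; rewrite !ord1 !mxE.
by have := h i (mem_index_enum _); rewrite /= sqrf_eq0 qnorm_eq0 => /eqP.
Qed.

(** Standard parts commute with products. Applied to an inverse matrix, this also carries
    appreciability from a vector to its image. *)
Lemma appreciable_mulmx M x : appreciable (M *m x) -> appreciable x.
Proof.
rewrite /appreciable map_mxM; apply: contra_neq => ->.
by rewrite mulmx0.
Qed.

Lemma norm2E x : appreciable x -> norm2 x = dsqrt (sqnorm x).
Proof. by rewrite /norm2 => ->. Qed.

Lemma norm2_sqr x : appreciable x -> norm2 x ^+ 2 = sqnorm x.
Proof. by move=> x0; rewrite norm2E // dsqrtK // -appreciableE. Qed.

Lemma norm2_eq1 x : norm2 x = 1 -> sqnorm x = 1.
Proof.
move=> x1; rewrite -norm2_sqr ?x1 ?expr1n //.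
(* In the other branch the norm has standard part 0 and cannot be 1. *)
move: x1; rewrite /norm2; case: ifP => // _ [/eqP].
by rewrite eq_sym oner_eq0.
Qed.

Lemma norm2_unit x : appreciable x -> norm2 x \is a GRing.unit.
Proof.
move=> x0; rewrite norm2E //.
by rewrite /in_mem /= /dunit /= unitfE gt_eqF // sqrtr_gt0 -appreciableE.
Qed.

Lemma norm2_le x y :
  appreciable y -> (sqnorm x <= sqnorm y)%O -> (norm2 x <= norm2 y)%O.
Proof.
move=> y0 xy; rewrite (norm2E y0).
have [x0|x0] := boolP (appreciable x).
  by rewrite norm2E // ler_dsqrt // -appreciableE.
(* Here [norm2 x] is infinitesimal, hence below any dual number with positive standard part. *)
by rewrite /norm2 (negbTE x0) dleE /= sqrtr_gt0 -appreciableE y0.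
Qed.

Lemma sqnorm_normalize x :
  appreciable x -> sqnorm (dq_of_dual (norm2 x)^-1 *: x) = 1.
Proof.
by move=> x0; rewrite sqnormZ -norm2_sqr // -exprMn mulVr ?expr1n ?norm2_unit.
Qed.

End InnerProduct.

(** * Residuals across one step of the iteration *)

Section RayleighQuotient.
Variables (R : realType) (n : nat) (A : 'M[dual_quaternion R]_n).
Hypothesis Ah : dqhermitian A.
Implicit Types x y : 'cV[dual_quaternion R]_n.
Implicit Types t : dual_number R.

Lemma inner_shift t x y :
  inner x ((A - (dq_of_dual t)%:M) *m y) =
  inner ((A - (dq_of_dual t)%:M) *m x) y.
Proof. by rewrite inner_mul adjmxB adjmx_dual Ah. Qed.

Lemma rayleigh_dual x : exists t, (adjmx x *m A *m x) 0 0 = dq_of_dual t.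
Proof.
apply: dqconj_fixed; rewrite -mulmxA -[(_ *m _) 0 0]/(inner x (A *m x)).
by rewrite inner_conj inner_mul Ah.
Qed.

(** The Rayleigh quotient minimizes the residual over dual shifts: [t - s] is the coefficient along
    [x] of the residual for [s], and passing to [t] projects it out. *)
Lemma rayleigh_residual_le t s x :
  sqnorm x = 1 -> (adjmx x *m A *m x) 0 0 = dq_of_dual t ->
  (sqnorm ((A - (dq_of_dual t)%:M) *m x) <=
   sqnorm ((A - (dq_of_dual s)%:M) *m x))%O.
Proof.
move=> x1; rewrite -mulmxA -[(_ *m _) 0 0]/(inner x (A *m x)) => tE.
have -> : (A - (dq_of_dual t)%:M) *m x =
    (A - (dq_of_dual s)%:M) *m x - dq_of_dual (t - s) *: x.
  rewrite !mulmxBl !mul_scalar_mx rmorphB scalerBl opprB.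
  by rewrite addrA subrK.
rewrite sqnorm_sub_proj //; last first.
  by rewrite mulmxBl mul_scalar_mx innerBr innerZr innerxx x1 mulr1 tE rmorphB.
by rewrite -dsubr_ge0 opprB addrC subrK dsqr_ge0.
Qed.

(** Cauchy-Schwarz for a unit vector, from the nonnegativity of N (y - t x). *)
Lemma sqr_inner_le t x y :
  sqnorm x = 1 -> inner x y = dq_of_dual t ->
  (t ^+ 2 <= sqnorm y :> dual_number R)%O.
Proof.
by move=> x1 xy; rewrite -dsubr_ge0 -(sqnorm_sub_proj x1 xy) sqnorm_ge0.
Qed.

Lemma rqi_step_residual_le t s x w :
  let v := dq_of_dual (norm2 w)^-1 *: w in
  mxinvertible (A - (dq_of_dual s)%:M) -> sqnorm x = 1 ->
  (A - (dq_of_dual s)%:M) *m w = x ->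
  (adjmx v *m A *m v) 0 0 = dq_of_dual t ->
  (norm2 ((A - (dq_of_dual t)%:M) *m v) <=
   norm2 ((A - (dq_of_dual s)%:M) *m x))%O.
Proof.
move=> v [B [_ BM]] x1 wE vt; set M := A - (dq_of_dual s)%:M in BM wE *.
have x0 : appreciable x by rewrite appreciableE x1 ltr01.
(* This makes [norm2 w] invertible, so that the normalization is genuine. *)
have w0 : appreciable w by apply: (@appreciable_mulmx _ _ M); rewrite wE.
have v1 : sqnorm v = 1 by exact: sqnorm_normalize.
have Mv : M *m v = dq_of_dual (norm2 w)^-1 *: x.
  rewrite -wE /v; apply/matrixP => i j; rewrite !mxE mulr_sumr.
  by apply: eq_bigr => k _; rewrite !mxE !mulrA dq_of_dual_comm.
apply: norm2_le.
  (* The inverse [B] sends the residual back to the appreciable [x]. *)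
  by apply: (@appreciable_mulmx _ _ B); rewrite mulmxA BM mul1mx.
apply: (le_trans (rayleigh_residual_le s v1 vt)).
rewrite -/M Mv sqnormZ x1 mulr1; apply: (sqr_inner_le v1).
(* [M] is self-adjoint, so <v, M x> = <M v, x>, and M v is x scaled by 1 / |w|. *)
by rewrite /M inner_shift -/M Mv innerZl innerxx x1 rmorph1 mulr1.
Qed.

End RayleighQuotient.

(** * From one step to the whole iteration *)

Theorem theorem4p3 (R : realType) (n : nat) (A : 'M[dual_quaternion R]_n)
    (u0 : 'cV[dual_quaternion R]_n) (u : nat -> 'cV[dual_quaternion R]_n)
    (theta : nat -> dual_quaternion R) (r : nat -> 'cV[dual_quaternion R]_n) :
  dqhermitian A ->
  norm2 u0 = 1 ->
  rqi A u0 u theta ->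
  (forall k, r k = (A - (theta k)%:M) *m u k) ->
  forall k, rqi_reached A theta k.+1 -> (norm2 (r k.+1) <= norm2 (r k))%O.
Proof.
move=> Ah u01 [u0E uS] rE k reach.
have reachW j : (j <= k.+1)%N -> rqi_reached A theta j.
  by move=> jk i ij; apply: reach; exact: leq_trans jk.
have unit_u j : (j <= k)%N -> sqnorm (u j) = 1.
  elim: j => [_|j IHj jk]; first by rewrite u0E norm2_eq1.
  have [_] := uS j (reachW _ (leqW (ltnW jk))).
  case=> [|w [wE ->]]; first by apply: reach; exact: leqW.
  (* The solution [w] is appreciable because its image [u j] has norm 1 by induction. *)
  apply: sqnorm_normalize; apply: (@appreciable_mulmx _ _ (A - (theta j)%:M)).
  by rewrite wE appreciableE IHj ?ltr01 // ltnW.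
have [thk] := uS k (reachW _ (leqnSn k)).
have inv_k := reach k (ltnSn k); case=> // w [wE uE].
have [thk1 _] := uS k.+1 reach.
have [s sE] := rayleigh_dual Ah (u k).
have [t tE] := rayleigh_dual Ah (u k.+1).
(* Both shifts are replaced by the dual numbers [s] and [t], as the one-step bound requires. *)
rewrite sE in thk; rewrite thk in inv_k wE.
rewrite !rE thk1 thk tE; rewrite uE in tE *.
exact: rqi_step_residual_le inv_k (unit_u k (leqnn k)) wE tE.
Qed.
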